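(* Let $\chi_1,\chi_2$ be nontrivial primitive Dirichlet characters modulo $q_1,q_2$ respectively, with $\chi_1\chi_2(-1)=1$. Let $\begin{pmatrix}a&b\\c&d\end{pmatrix}\in\Gamma_0(q_1q_2)$ with $c=rq_1q_2$ for some positive integer $r$. Then \[ S_{\chi_1,\chi_2}(a,c)=\frac{z}{rq_1}\quad\text{for some } z\in\mathbb{Z}[\chi_1,\chi_2]. \]
   Context: $B_1(x)=0$ if $x\in\mathbb{Z}$ and $B_1(x)=x-\lfloor x\rfloor-\tfrac12$ otherwise. $\Gamma_0(N)$ is the group of matrices in $SL_2(\mathbb{Z})$ whose lower-left entry is divisible by $N$. For such a matrix with $c\ge1$, \[S_{\chi_1,\chi_2}(a,c)=\sum_{j \bmod c}\ \sum_{n \bmod q_1}\overline{\chi_2}(j)\overline{\chi_1}(n)B_1\Big(\frac{j}{c}\Big)B_1\Big(\frac{n}{q_1}+\frac{aj}{c}\Big).\] $\mathbb{Z}[\chi_1,\chi_2]$ denotes the ring of integers of the smallest number field containing all values of $\chi_1$ and $\chi_2$. *)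

(* Defs.v *)
From HB Require Import structures.
From mathcomp Require Import all_boot all_order all_algebra.
From mathcomp Require Import complex reals.

Set Implicit Arguments.
Unset Strict Implicit.
Unset Printing Implicit Defensive.

Import Order.TTheory GRing.Theory Num.Theory.

Local Open Scope ring_scope.
Local Open Scope complex_scope.

Definition B1 (R : realType) (x : R) : R :=
  if x \is a Num.int then 0 else x - (Num.floor x)%:~R - 2^-1.

(* Dirichlet characters are viewed as functions on the integers, extended by
   zero outside the integers coprime to the modulus. *)
Definition dirichlet_character (R : realType) (q : nat) (chi : int -> R[i]) :
    Prop :=
  [/\ (0 < q)%N,
      (forall m n : int, (m = n %[mod q])%Z -> chi m = chi n),
      (forall m n : int, chi (m * n) = chi m * chi n),
      chi 1 = 1
    & (forall n : int, (chi n != 0) = coprimez n q)].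

Definition nontrivial_character (R : realType) (q : nat) (chi : int -> R[i]) :
    Prop :=
  exists2 n : int, coprimez n q & chi n != 1.

Definition induced_from (R : realType) (q : nat) (chi : int -> R[i]) (d : nat) :
    Prop :=
  exists2 psi : int -> R[i], dirichlet_character d psi
    & forall n : int, coprimez n q -> chi n = psi n.

Definition primitive_character (R : realType) (q : nat) (chi : int -> R[i]) :
    Prop :=
  dirichlet_character q chi /\
  forall d : nat, (d %| q)%N -> (d < q)%N -> ~ induced_from q chi d.

Definition Gamma0 (N : nat) (M : 'M[int]_2) : Prop :=
  \det M = 1 /\ (N %| M 1%R 0%R)%Z.

(* The residues modulo c and q1 are represented by 0, ..., c - 1 and
   0, ..., q1 - 1; the sum is independent of representatives as soon as chi2
   has period dividing c. *)
Definition dedekind_sum (R : realType) (q1 : nat) (chi1 chi2 : int -> R[i])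
    (a : int) (c : nat) : R[i] :=
  \sum_(j < c) \sum_(n < q1)
    (chi2 j%:Z)^* * (chi1 n%:Z)^* *
    (B1 (j%:R / c%:R : R))%:C *
    (B1 (n%:R / q1%:R + a%:~R * j%:R / c%:R : R))%:C.

(* The smallest subfield of the complex numbers containing all the values of
   chi1 and chi2, as the intersection of all such subfields; for Dirichlet
   characters it is generated by finitely many roots of unity, hence it is a
   number field. *)
Definition in_value_field (R : realType) (chi1 chi2 : int -> R[i]) (z : R[i]) :
    Prop :=
  forall K : {pred R[i]}, divring_closed K ->
    (forall n : int, chi1 n \in K) -> (forall n : int, chi2 n \in K) -> z \in K.

Definition in_value_ring (R : realType) (chi1 chi2 : int -> R[i]) (z : R[i]) :
    Prop :=
  in_value_field chi1 chi2 z /\ integralOver (intr : int -> R[i]) z.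

(* Main.v *)
(* Put c = r q1 q2 and split B1(j/c) = ((j mod q2)/c - 1/2) + (j div q2)/(r q1)
   (for j not divisible by c).  The first part is q2-periodic in j; since a is
   invertible modulo c, shifting j by a suitable multiple of q2 absorbs
   n/q1 = n r q2/c, so its contribution has an inner sum independent of n and
   is killed by sum_n chi1(n) = 0.  The second part supplies the denominator
   r q1.  There B1(m/c) = m/c - 1/2 - floor(m/c), because chi2(j) <> 0 prevents
   c from dividing m = a j + n r q2; the m/c - 1/2 part cancels since chi1 and
   chi2 sum to zero over a period, and what remains is an integral combination
   of products of values of the conjugate characters. *)
Require Import Defs.
From mathcomp Require Import all_boot all_order all_algebra.
From mathcomp Require Import complex reals cyclic ring.

Set Implicit Arguments.
Unset Strict Implicit.

Import Order.TTheory GRing.Theory Num.Theory.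
Local Open Scope ring_scope.
Local Open Scope complex_scope.

(** * Reindexing sums over residues *)

Lemma sum_periodic_reindex (V : nmodType) (c : nat) (f : int -> V)
    (h : int -> int) :
  (forall m n, (m = n %[mod c])%Z -> f m = f n) ->
  (forall m n, (h m = h n %[mod c])%Z -> (m = n %[mod c])%Z) ->
  \sum_(j < c) f (h j%:Z) = \sum_(j < c) f j%:Z.
Proof.
case: c => [|c] fper hinj; first by rewrite !big_ord0.
have hmod_lt (j : 'I_c.+1) : (`|(h j%:Z %% c.+1)%Z|%N < c.+1)%N.
  by rewrite -ltz_nat gez0_abs ?modz_ge0 // ltz_mod.
(* Reducing [h] modulo [c] gives an injective self-map of a finite set, hence a permutation. *)
pose h' j := Ordinal (hmod_lt j).
have h'E j : (h' j)%:Z = (h j%:Z %% c.+1)%Z by rewrite /= gez0_abs ?modz_ge0.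
have h'_inj : injective h'.
  move=> j k /(congr1 (fun i : 'I_ _ => (i : nat)%:Z)); rewrite !h'E => /hinj.
  by rewrite !modz_nat => -[]; rewrite !modn_small //; apply: val_inj.
rewrite [RHS](reindex_inj h'_inj); apply: eq_bigr => j _; apply: fper.
by rewrite h'E modz_mod.
Qed.

(** * Vanishing sums and integrality of Dirichlet characters *)

Section DirichletCharacters.

Variables (R : realType) (q : nat) (chi : int -> R[i]).
Hypothesis chiP : dirichlet_character q chi.

Lemma dirichlet_conj : dirichlet_character q (fun n => (chi n)^*).
Proof.
case: chiP => q_gt0 per mul one unit; split=> //.
- by move=> m n /per->.
- by move=> m n; rewrite mul rmorphM.
- by rewrite one rmorph1.
- by move=> n; rewrite conjc_eq0 unit.
Qed.

Lemma nontrivial_conj :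
  nontrivial_character q chi -> nontrivial_character q (fun n => (chi n)^*).
Proof.
case=> n cop ne1; exists n => //; apply: contraNneq ne1 => e.
by rewrite -[chi n]conjcK e rmorph1.
Qed.

(** Nontriviality excludes [q = 1], the only modulus for which a multiple of [q] is coprime to
    [q]. *)
Lemma dirichlet_dvd_eq0 n :
  nontrivial_character q chi -> (q %| n)%Z -> chi n = 0.
Proof.
case: chiP => q_gt0 per mul one unit [m _ ne1] qn.
apply/eqP; apply/negPn; rewrite unit /coprimez.
apply: contraNN ne1 => /eqP cop.
have : (q %| gcdz n q)%Z by rewrite dvdz_gcd qn dvdzz.
rewrite cop dvdz1 => /eqP q1.
by rewrite (per m 1) ?one //; move/eqP: q1; rewrite absz_nat => /eqP->; rewrite !modz1.
Qed.

(** Multiplication by a unit [u] with [chi u != 1] permutes the residues, so the sum is fixed by the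
    factor [chi u]. *)
Lemma sum_dirichlet : nontrivial_character q chi -> \sum_(n < q) chi n%:Z = 0.
Proof.
case: chiP => q_gt0 per mul one unit [u cop ne1].
have : \sum_(n < q) chi (u * n%:Z) = \sum_(n < q) chi n%:Z.
  apply: sum_periodic_reindex => // m n /eqP.
  rewrite eqz_mod_dvd -mulrBr Gauss_dvdzr 1?coprimez_sym // => mn.
  by apply/eqP; rewrite eqz_mod_dvd.
rewrite (eq_bigr (fun n : 'I_q => chi u * chi n%:Z)) => [|n _]; last exact: mul.
rewrite -mulr_sumr => /eqP; rewrite -subr_eq0 -{2}[\sum_(_ < _) _]mul1r -mulrBl.
by rewrite mulf_eq0 subr_eq0 (negPf ne1) => /eqP.
Qed.

(** The quotient is constant on each block of [q] consecutive indices, and [chi] sums to zero over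
    every block. *)
Lemma sum_dirichlet_divn m :
  nontrivial_character q chi ->
  \sum_(j < m * q) chi j%:Z * (j %/ q)%:R = 0.
Proof.
case: (chiP) => q_gt0 per _ _ _ nt.
rewrite -(big_mkord xpredT (fun j => chi j%:Z * (j %/ q)%:R)) big_nat_mul.
rewrite big1 // => k _.
rewrite -{1}[(k * q)%N]add0n mulSn big_addn addnK big_mkord.
rewrite (eq_bigr (fun j : 'I_q => chi j%:Z * k%:R)) => [|j _].
  by rewrite -mulr_suml sum_dirichlet ?mul0r.
rewrite divnDMl // divn_small // add0n; congr (_ * _); apply: per.
by rewrite PoszD PoszM addrC modzMDl.
Qed.

Lemma dirichlet_totient n : coprimez n q -> chi n ^+ totient q = 1.
Proof.
case: chiP => q_gt0 per mul one _ cop.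
(* A natural representative of [n], to which Euler's theorem applies. *)
pose m := `|(n %% q)%Z|%N.
have mE : m%:Z = (n %% q)%Z by rewrite gez0_abs // modz_ge0 // -lt0n.
have cop_m : coprime m q.
  by rewrite -[m]absz_nat mE -[q]absz_nat -coprimezE /coprimez gcdz_modl.
have chim : chi n = chi m%:Z by apply: per; rewrite mE modz_mod.
have chiX k : chi (m ^ k)%N%:Z = chi n ^+ k.
  elim: k => [|k IHk]; first by rewrite one.
  by rewrite expnS PoszM mul IHk exprS chim.
rewrite -chiX (per _ 1) ?one // -[1]/(1%N%:Z) !modz_nat.
by rewrite Euler_exp_totient.
Qed.

Lemma dirichlet_integral n : integralOver (intr : int -> R[i]) (chi n).
Proof.
case: (chiP) => q_gt0 _ _ _ unit.
have [/eqP->|] := boolP (chi n == 0); first exact: integral0.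
rewrite unit => /dirichlet_totient chi1.
have root1 : root ('X^(totient q) - 1) (chi n).
  by rewrite rootE !hornerE chi1 subrr.
apply: (integral_root_monic _ root1).
  by rewrite monicXnsubC // totient_gt0.
apply/integral_poly => i.
by rewrite coefB coefXn coef1; apply: integral_sub; apply: integral_nat.
Qed.

(** Nonzero values are roots of unity. This form serves because the value field is closed under
    division by definition, but not visibly under conjugation. *)
Lemma dirichlet_conjE n : (chi n)^* = (chi n)^-1.
Proof.
case: (chiP) => q_gt0 _ _ _ unit.
have [/eqP->|] := boolP (chi n == 0); first by rewrite invr0 conjc0.
rewrite unit => /dirichlet_totient chi1.
have norm1 : `|chi n| = 1.
  apply/eqP; rewrite -(pexpr_eq1 (n := totient q)) ?totient_gt0 //.
  by rewrite -normrX chi1 normr1.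
by rewrite invc_norm norm1 expr1n invr1 mul1r.
Qed.

End DirichletCharacters.

(** * [B1] at fractions, through integer division *)

Lemma B1_frac (R : realType) (c : nat) (m : int) : (0 < c)%N ->
  (B1 (m%:~R / c%:R : R))%:C =
    if (c %| m)%Z then 0 else m%:~R / c%:R - (m %/ c)%Z%:~R - 2^-1 :> R[i].
Proof.
move=> c_gt0; have cR_gt0 : 0 < c%:R :> R by rewrite ltr0n.
have cR_neq0 : c%:R != 0 :> R by rewrite gt_eqF.
have c_neq0 : c%:Z != 0 by rewrite -lt0n.
rewrite /B1.
have -> : (m%:~R / c%:R : R) \is a Num.int = (c %| m)%Z.
  apply/idP/idP => [/intrP[k /eqP]|/dvdzP[k ->]].
    rewrite (can2_eq (mulfVK _) (mulfK _)) // -[c%:R]/(c%:Z%:~R).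
    by rewrite -intrM eqr_int => /eqP->; rewrite dvdz_mull.
  by rewrite intrM mulfK.
have -> : Num.floor (m%:~R / c%:R : R) = (m %/ c)%Z.
  apply: floor_def; rewrite ler_pdivlMr // ltr_pdivrMr // -[c%:R]/(c%:Z%:~R).
  by rewrite -!intrM ler_int ltr_int lez_floor // ltz_ceil.
case: ifP => _; first exact: rmorph0.
by rewrite !rmorphB /= fmorph_div !rmorph_int rmorph_nat fmorphV rmorph_nat.
Qed.

(** * Closure properties of the value ring *)

Section ValueRing.

Variables (R : realType) (chi1 chi2 : int -> R[i]).
Local Notation inZ := (in_value_ring chi1 chi2).

Lemma in_value_ringD x y : inZ x -> inZ y -> inZ (x + y).
Proof.
move=> [xK xZ] [yK yZ]; split; last exact: integral_add.
move=> K Kring K1 K2; have [_ KD] := GRing.zmod_closedD (GRing.divring_closedBM Kring).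
by apply: KD; [apply: xK | apply: yK].
Qed.

Lemma in_value_ringM x y : inZ x -> inZ y -> inZ (x * y).
Proof.
move=> [xK xZ] [yK yZ]; split; last exact: integral_mul.
move=> K Kring K1 K2; have [_ KM] := GRing.smulr_closedM (GRing.divring_closedBM Kring).
by apply: KM; [apply: xK | apply: yK].
Qed.

Lemma in_value_ring_int (m : int) : inZ m%:~R.
Proof.
split; last exact: integral_id.
move=> K Kring _ _; have [K1 KB _] := Kring.
have K0 : 0 \in K by rewrite -(subrr 1) KB.
elim/int_rec: m => // n.
- move=> Kn; rewrite intS rmorphD /= -[X in 1 + X]opprK KB // -sub0r KB //.
- by move=> Kn; rewrite intS opprD addrC rmorphB KB.
Qed.

Lemma in_value_ring_sum (I : finType) (F : I -> R[i]) :
  (forall i, inZ (F i)) -> inZ (\sum_i F i).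
Proof.
move=> FZ; apply: (big_ind inZ) => //; last exact: in_value_ringD.
exact: (in_value_ring_int 0).
Qed.

Lemma in_value_ringV x : inZ x -> integralOver (intr : int -> R[i]) x^-1 -> inZ x^-1.
Proof.
move=> [xK _] xZ; split=> // K Kring K1 K2; have [K1' _ KV] := Kring.
by rewrite -[x^-1]mul1r KV // xK.
Qed.

End ValueRing.

(** * Reduction of the double sum to an integral combination over [r * q1] *)

Section Reduction.

(** [psi1] and [psi2] will be the conjugates of [chi1] and [chi2]; [det1] makes [d] an inverse of
    [a] modulo [c]. *)
Variables (R : realType) (q1 q2 r c : nat) (psi1 psi2 : int -> R[i]) (a b d : int).
Hypotheses (psi1P : dirichlet_character q1 psi1)
  (psi2P : dirichlet_character q2 psi2)
  (nt1 : nontrivial_character q1 psi1) (nt2 : nontrivial_character q2 psi2)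
  (r_gt0 : (0 < r)%N) (hc : c = (r * q1 * q2)%N)
  (det1 : a * d - b * c%:Z = 1).

(** Numerator of [n / q1 + a j / c] over the common denominator [c = r q1 q2]. *)
Local Notation arg j n := (n%:Z * r%:Z * q2%:Z + a * j%:Z).
Local Notation saw m := (B1 (m%:~R / c%:R : R))%:C.

Let q1_gt0 : (0 < q1)%N. Proof. by case: psi1P. Qed.
Let q2_gt0 : (0 < q2)%N. Proof. by case: psi2P. Qed.
Let c_gt0 : (0 < c)%N. Proof. by rewrite hc !muln_gt0 r_gt0 q1_gt0. Qed.
Let q2_dvd_c : (q2%:Z %| c%:Z)%Z. Proof. by rewrite hc PoszM dvdz_mull. Qed.

Let cE : c%:R = r%:R * q1%:R * q2%:R :> R[i].
Proof. by rewrite hc !natrM. Qed.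
Let r_neq0 : r%:R != 0 :> R[i]. Proof. by rewrite pnatr_eq0 -lt0n. Qed.
Let q1_neq0 : q1%:R != 0 :> R[i]. Proof. by rewrite pnatr_eq0 -lt0n. Qed.
Let q2_neq0 : q2%:R != 0 :> R[i]. Proof. by rewrite pnatr_eq0 -lt0n. Qed.
Let c_neq0 : c%:R != 0 :> R[i]. Proof. by rewrite pnatr_eq0 -lt0n. Qed.

Lemma saw_periodic m n : (m = n %[mod c])%Z -> saw m = saw n.
Proof.
move=> mn; rewrite !B1_frac //.
have -> : (c %| m)%Z = (c %| n)%Z.
  by apply/dvdz_mod0P/dvdz_mod0P; rewrite mn.
case: ifP => // _; congr (_ - _).
(* The fractional part of [k / c] depends only on the residue of [k]. *)
suff saw_mod k : k%:~R / c%:R - (k %/ c)%Z%:~R = (k %% c)%Z%:~R / c%:R :> R[i].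
  by rewrite !saw_mod mn.
rewrite {1}(divz_eq k c) rmorphD rmorphM /= mulrDl mulfK //.
by rewrite addrAC subrr add0r.
Qed.

(* Shifting j by d n r q2 turns arg j n into a * j modulo c without changing f,
   so the inner sum over j does not depend on n. *)
Lemma sum_psi1_periodic_saw (f : int -> R[i]) :
  (forall m n, (m = n %[mod q2])%Z -> f m = f n) ->
  \sum_(j < c) \sum_(n < q1) f j%:Z * psi1 n%:Z * saw (arg j n) = 0.
Proof.
move=> fper; rewrite exchange_big /=.
rewrite (eq_bigr (fun n : 'I_q1 =>
    psi1 n%:Z * \sum_(j < c) f j%:Z * saw (a * j%:Z))) => [|n _].
  by rewrite -mulr_suml sum_dirichlet ?mul0r.
have cper_f m k : (m = k %[mod c])%Z -> f m = f k.
  move=> /eqP; rewrite eqz_mod_dvd => mk; apply: fper; apply/eqP.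
  by rewrite eqz_mod_dvd (dvdz_trans q2_dvd_c).
pose s := d * n%:Z * r%:Z * q2%:Z.
rewrite -(@sum_periodic_reindex _ c (fun j => f j * saw (a * j)) (fun j => j + s)).
- rewrite mulr_sumr; apply: eq_bigr => j _.
  rewrite [f _ * _]mulrC -[psi1 _ * _ * _]mulrA; congr (_ * (_ * _)).
    by apply: fper; rewrite /s addrC modzMDl.
  apply: saw_periodic; apply/eqP; rewrite eqz_mod_dvd.
  have -> : arg j n - a * (j%:Z + s) = (1 - a * d) * (n%:Z * r%:Z * q2%:Z).
    by rewrite /s; ring.
  have -> : 1 - a * d = - b * c%:Z by rewrite -det1; ring.
  by rewrite dvdz_mulr // dvdz_mull.
- move=> m k mk; congr (_ * _); first exact: cper_f.
  by apply: saw_periodic; rewrite -modzMmr mk modzMmr.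
- by move=> m k /eqP; rewrite eqz_modDr => /eqP.
Qed.

Lemma saw_arg j n : psi2 j%:Z != 0 ->
  saw (arg j n) =
    n%:R / q1%:R + (a%:~R * j%:R / c%:R - 2^-1) - (arg j n %/ c)%Z%:~R.
Proof.
move=> psi2j; rewrite B1_frac //; case: ifP => [c_dvd|_].
  have q2_dvd : (q2 %| a * j%:Z)%Z.
    rewrite -(addKr (n%:Z * r%:Z * q2%:Z) (a * j%:Z)).
    by rewrite rpredD ?rpredN ?dvdz_mull // (dvdz_trans q2_dvd_c).
  case/eqP: psi2j; apply: (dirichlet_dvd_eq0 psi2P) => //.
  move: q2_dvd; rewrite Gauss_dvdzr // coprimez_sym.
  (* The determinant relation, with [c = r q1 q2], is a Bezout identity for [a] and [q2]; so [q2]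
     would divide [j]. *)
  apply/coprimezP; exists (d, - b * r%:Z * q1%:Z) => /=.
  by rewrite -det1 hc !PoszM; ring.
rewrite rmorphD !rmorphM /= -!pmulrn cE.
by field; rewrite r_neq0 q1_neq0 q2_neq0.
Qed.

Lemma double_sum_saw :
  \sum_(j < c) \sum_(n < q1)
    psi2 j%:Z * psi1 n%:Z * saw j%:Z * saw (arg j n) =
  (\sum_(j < c) \sum_(n < q1)
    psi2 j%:Z * psi1 n%:Z * (- (j %/ q2)%:Z * (arg j n %/ c)%Z)%:~R) /
  (r * q1)%:R.
Proof.
(* The [q2]-periodic part of [psi2 j * B1 (j / c)]. *)
pose f (m : int) : R[i] := psi2 m * ((m %% q2)%Z%:~R / c%:R - 2^-1).
have fper m n : (m = n %[mod q2])%Z -> f m = f n.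
  by move=> mn; rewrite /f mn; congr (_ * _); case: psi2P => _ per _ _ _; apply: per.
have rq1_neq0 : (r * q1)%:R != 0 :> R[i] by rewrite natrM mulf_neq0.
have sawj (j : 'I_c) : psi2 j%:Z * saw j%:Z =
    f j%:Z + psi2 j%:Z * (j %/ q2)%:R / (r * q1)%:R.
  (* If [c] divides [j], then [psi2 j = 0] and both sides vanish. *)
  rewrite B1_frac // /f; case: ifP => [c_dvd|_].
    by rewrite (dirichlet_dvd_eq0 psi2P) ?mul0r ?addr0 // (dvdz_trans q2_dvd_c).
  rewrite divz_nat divn_small // mulr0z subr0 modz_nat -!pmulrn.
  have -> : j%:R = (j %/ q2)%:R * q2%:R + (j %% q2)%:R :> R[i].
    by rewrite -natrM -natrD -divn_eq.
  rewrite cE natrM.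
  by field; rewrite r_neq0 q1_neq0 q2_neq0.
apply: (mulIf rq1_neq0); rewrite divfK //.
(* The value in [saw_arg] without its floor term. *)
set lin := fun (j n : nat) => n%:R / q1%:R + (a%:~R * j%:R / c%:R - 2^-1) : R[i].
(* Three contributions: the periodic part, the integer part that survives, and the linear part. *)
have term (j : 'I_c) (n : 'I_q1) :
    psi2 j%:Z * psi1 n%:Z * saw j%:Z * saw (arg j n) * (r * q1)%:R =
    f j%:Z * psi1 n%:Z * saw (arg j n) * (r * q1)%:R +
    psi2 j%:Z * psi1 n%:Z * (- (j %/ q2)%:Z * (arg j n %/ c)%Z)%:~R +
    psi2 j%:Z * psi1 n%:Z * (j %/ q2)%:R * lin j n.
  rewrite [psi2 _ * psi1 _ * saw _]mulrAC sawj.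
  have [->|psi2j] := eqVneq (psi2 j%:Z) 0; first by rewrite !mul0r !addr0.
  rewrite [(- _ * _)%:~R]intrM mulrNz saw_arg // -/(lin j n).
  by field; rewrite ?r_neq0 ?q1_neq0 ?c_neq0 ?rq1_neq0.
rewrite mulr_suml.
under eq_bigr => j _ do rewrite mulr_suml (eq_bigr _ (fun n _ => term j n)) !big_split.
rewrite !big_split /=.
have -> : \sum_(j < c) \sum_(n < q1) f j%:Z * psi1 n%:Z * saw (arg j n) * (r * q1)%:R = 0.
  under eq_bigr => j _ do rewrite -mulr_suml.
  by rewrite -mulr_suml sum_psi1_periodic_saw ?mul0r.
rewrite add0r -[RHS]addr0; congr (_ + _).
(* In [lin j n] the summand free of [n] is killed by the sum of [psi1]; what is left factors into a
   sum over [j] and a sum over [n]. *)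
have split_lin (j : 'I_c) :
    \sum_(n < q1) psi2 j%:Z * psi1 n%:Z * (j %/ q2)%:R * lin j n =
    psi2 j%:Z * (j %/ q2)%:R * \sum_(n < q1) psi1 n%:Z * (n%:R / q1%:R).
  transitivity (psi2 j%:Z * (j %/ q2)%:R * \sum_(n < q1) psi1 n%:Z * (n%:R / q1%:R) +
     psi2 j%:Z * (j %/ q2)%:R * (a%:~R * j%:R / c%:R - 2^-1) * \sum_(n < q1) psi1 n%:Z).
    by rewrite !mulr_sumr -big_split; apply: eq_bigr => n _; rewrite /lin /=; ring.
  by rewrite sum_dirichlet // mulr0 addr0.
rewrite (eq_bigr _ (fun j _ => split_lin j)) -mulr_suml.
(* The [j]-factor vanishes, as the range [c] consists of [r * q1] blocks of length [q2]. *)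
by have := sum_dirichlet_divn psi2P (r * q1) nt2; rewrite -hc => ->; rewrite mul0r.
Qed.

End Reduction.

Unset Implicit Arguments.
Set Strict Implicit.

(** * Application to the conjugate characters and the matrix entries *)

Theorem theorem3p1 (R : realType) (q1 q2 : nat) (chi1 chi2 : int -> R[i])
    (prim1 : primitive_character q1 chi1) (prim2 : primitive_character q2 chi2)
    (nontriv1 : nontrivial_character q1 chi1)
    (nontriv2 : nontrivial_character q2 chi2)
    (parity : chi1 (-1) * chi2 (-1) = 1)
    (M : 'M[int]_2) (hM : Gamma0 (q1 * q2) M)
    (r c : nat) (r_gt0 : (0 < r)%N)
    (hc : c = (r * q1 * q2)%N) (hMc : M 1 0 = c%:Z) :
  exists z : R[i], in_value_ring chi1 chi2 z /\
    dedekind_sum q1 chi1 chi2 (M 0 0) c = z / (r * q1)%:R.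
Proof.
case: prim1 prim2 hM => chi1P _ [chi2P _] [detM _].
have det1 : M 0 0 * M 1 1 - M 0 1 * c%:Z = 1.
  rewrite -hMc -detM (expand_det_row _ 0) !big_ord_recl big_ord0.
  rewrite /cofactor !det_mx11 !mxE /= addn0 expr0 expr1 mul1r mulN1r mulrN addr0.
  by congr (M _ _ * M _ _ - M _ _ * M _ _); apply: val_inj.
have [q1_gt0 _ _ _ _] := chi1P; have [q2_gt0 _ _ _ _] := chi2P.
have := double_sum_saw (dirichlet_conj chi1P) (dirichlet_conj chi2P)
  (nontrivial_conj nontriv1) (nontrivial_conj nontriv2) r_gt0 hc det1.
set z := (X in _ = X / _) => sumE; exists z; split; last first.
  rewrite -sumE.
  apply: eq_bigr => j _; apply: eq_bigr => n _; congr (_ * (B1 _)%:C).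
  (* It remains to identify [n / q1 + a j / c] with the fraction used in the reduction. *)
  have q1_neq0 : q1%:R != 0 :> R by rewrite pnatr_eq0 -lt0n.
  have q2_neq0 : q2%:R != 0 :> R by rewrite pnatr_eq0 -lt0n.
  have r_neq0 : r%:R != 0 :> R by rewrite pnatr_eq0 -lt0n.
  have -> : c%:R = r%:R * q1%:R * q2%:R :> R by rewrite hc !natrM.
  rewrite rmorphD !rmorphM /= -!pmulrn.
  by field; rewrite r_neq0 q1_neq0 q2_neq0.
apply: in_value_ring_sum => j; apply: in_value_ring_sum => n.
apply: in_value_ringM; last exact: in_value_ring_int.
apply: in_value_ringM.
(* As an inverse, the conjugate value lies in the value field; as a value of a Dirichlet character,
   it is integral. *)
- rewrite (dirichlet_conjE chi2P); apply: in_value_ringV.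
    by split; [move=> K _ _; apply | apply: dirichlet_integral chi2P _].
  by rewrite -(dirichlet_conjE chi2P); apply: dirichlet_integral (dirichlet_conj chi2P) _.
- rewrite (dirichlet_conjE chi1P); apply: in_value_ringV.
    by split; [move=> K _ + _; apply | apply: dirichlet_integral chi1P _].
  by rewrite -(dirichlet_conjE chi1P); apply: dirichlet_integral (dirichlet_conj chi1P) _.
Qed.
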